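(* Let $\lambda_n^{(1)} \leq \cdots \leq \lambda_n^{(n)}$ be the eigenvalues of the $n\times n$ GCD matrix $(S_n)=\big((i,j)\big)_{1\le i,j\le n}$ defined on $S_n=\{1,2,\ldots,n\}$, where $(i,j)$ denotes the greatest common divisor of $i$ and $j$. Then $$\frac{n+1}{2}-s(n-1)^{1/2} < \lambda_n^{(1)} < \frac{n+1}{2}-\left(\frac{ns^2+2(n-1)}{n^2-n}\right)^{1/2}$$ and $$\frac{n+1}{2}+\left(\frac{ns^2+2(n-1)}{n^2-n}\right)^{1/2} < \lambda_n^{(n)} < \frac{n+1}{2}+s(n-1)^{1/2},$$ where $$s=\left(\frac{2}{n}\sum_{i=1}^n (N^2 \ast \varphi)(i)-\frac{7n^2+12n+5}{12}\right)^{1/2}.$$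
   Context: For arithmetical functions $f,g$ (functions on the positive integers), the Dirichlet product is $(f\ast g)(n)=\sum_{d\mid n} f(d)\,g(n/d)$, and the usual product is pointwise, $(fg)(n)=f(n)g(n)$. $N$ is the arithmetical function $N(n)=n$, so $N^2(n)=n^2$. $\varphi$ is Euler's totient function.
   Formalization: The formal theorem assumes n ≥ 3: for n = 1 the denominator n²−n vanishes, and for n = 2 the claim is false (eigenvalues (3±√5)/2, s² = 5/4: the outer bounds are equalities and the inner bounds fail). *)

(* Defs.v *)
From mathcomp Require Import all_boot all_order all_algebra.

Set Implicit Arguments.
Unset Strict Implicit.
Unset Printing Implicit Defensive.

Import Order.TTheory GRing.Theory Num.Theory.

Local Open Scope ring_scope.

(* Arithmetical functions are functions nat -> R of which only the values at
   positive arguments matter; the pointwise product is the library's f \* g. *)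
Definition dirichlet (R : nzSemiRingType) (f g : nat -> R) (n : nat) : R :=
  \sum_(d <- divisors n) f d * g (n %/ d)%N.

Definition arithN (R : nzSemiRingType) (n : nat) : R := n%:R.

Definition arith_totient (R : nzSemiRingType) (n : nat) : R := (totient n)%:R.

(* Index i : 'I_n stands for the element i.+1 of S_n = {1, ..., n}. *)
Definition gcd_matrix (R : nzSemiRingType) (n : nat) : 'M[R]_n :=
  \matrix_(i < n, j < n) (gcdn i.+1 j.+1)%:R.

(* lam lists all the eigenvalues of A, repeated according to multiplicity, in
   nondecreasing order; it is the unique such list when it exists, and for a
   symmetric A over a real closed field it always exists. *)
Definition ordered_eigenvalues (R : rcfType) (n : nat) (A : 'M[R]_n)
    (lam : n.-tuple R) : Prop :=
  sorted <=%R lam /\ char_poly A = \prod_(x <- lam) ('X - x%:P).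

Definition gcd_spread (R : rcfType) (n : nat) : R :=
  Num.sqrt
    (2%:R / n%:R *
       (\sum_(1 <= i < n.+1)
          dirichlet (@arithN R \* @arithN R) (@arith_totient R) i)
     - (7%:R * n%:R ^+ 2 + 12%:R * n%:R + 5%:R) / 12%:R).

(* Main.v *)
Require Import Defs.
From mathcomp Require Import all_boot all_order all_algebra all_fingroup.
From mathcomp Require Import sesquilinear spectral complex ring lra zify.

Import Order.TTheory GRing.Theory Num.Theory.
Local Open Scope ring_scope.
Local Open Scope sesquilinear_scope.

(* By Cesaro's identity the radicand of s is the variance of the eigenvalues,
   tr(S^2)/n - m^2, where m = tr(S)/n = (n+1)/2. The outer bounds are
   Cauchy-Schwarz for the n - 1 eigenvalues other than the extreme one; equality
   would make those coincide, and S minus a scalar would have rank one, which its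
   entries forbid for n > 2. For the inner bounds, Rayleigh quotients at
   e_(n-1) + e_n and e_1 - e_2 give lam_max >= n + 1/2 and lam_min <= 1/2, so both
   extreme eigenvalues are at distance at least n/2 from m, and q < n/2 follows
   from an upper bound on the sum of gcd(i,j)^2. *)

(** * Unitary diagonalization of real symmetric matrices *)

Lemma char_poly_conj (F : comUnitRingType) n (P A : 'M[F]_n) :
  P \in unitmx -> char_poly (invmx P *m A *m P) = char_poly A.
Proof.
move=> Pu; pose toP (B : 'M[F]_n) := map_mx (@polyC F) B.
have -> : char_poly (invmx P *m A *m P)
  = \det (toP (invmx P) *m char_poly_mx A *m toP P).
  rewrite /char_poly /char_poly_mx /toP mulmxBr mulmxBl scalar_mxC.
  rewrite -(mulmxA _ _ (map_mx _ P)).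
  by rewrite -!map_mxM /= mulVmx // map_mx1 mulmx1.
rewrite /toP !det_mulmx mulrAC -det_mulmx -map_mxM mulVmx // map_mx1 det1.
by rewrite mul1r.
Qed.

Lemma unitary_row_perm (C : numClosedFieldType) n (s : 'S_n) (U : 'M[C]_n) :
  U \is unitarymx -> row_perm s U \is unitarymx.
Proof.
move=> Uu; rewrite row_permE mul_unitarymx //; apply/unitarymxP.
by rewrite tr_perm_mx map_perm_mx -perm_mxM mulgV perm_mx1.
Qed.

(** Over [R[i]] the matrix is Hermitian, so the spectral theorem applies, but with the eigenvalues
    in an uncontrolled order. Comparing the factorizations of the characteristic polynomial gives a
    permutation between that order and [lam], which is absorbed into the rows of the unitary
    matrix. *)
Lemma symmetric_unitary_diag (R : rcfType) n (A : 'M[R]_n) (lam : n.-tuple R) :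
  A^T = A -> char_poly A = \prod_(x <- lam) ('X - x%:P) ->
  exists2 U : 'M[R[i]]_n, U \is unitarymx &
    map_mx (real_complex R) A =
      U^t* *m diag_mx (\row_k (real_complex R (tnth lam k))) *m U.
Proof.
move=> Asym charA; pose AC := map_mx (real_complex R) A.
have ACherm : AC \is hermsymmx.
  apply: realsym_hermsym.
    by apply/is_hermitianmxP; rewrite expr0 scale1r map_mx_id // map_trmx Asym.
  apply/mxOverP => i j; rewrite mxE; apply/complex_realP.
  by exists (A i j).
have /hermitian_normalmx/orthomx_spectralP ACE := ACherm.
set P := spectralmx AC in ACE; set d := spectral_diag AC in ACE.
have Pu : P \is unitarymx := spectral_unitarymx AC.
pose D : n.-tuple R[i] := [tuple d 0 i | i < n].
have : char_poly AC = \prod_(x <- D) ('X - x%:P).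
  rewrite ACE char_poly_conj ?unitarymx_unit // char_poly_trig ?diag_mx_is_trig //.
  by rewrite big_tuple; apply: eq_bigr => i _; rewrite tnth_mktuple mxE eqxx.
rewrite /AC -map_char_poly charA rmorph_prod /=.
under eq_bigr do rewrite map_polyXsubC.
rewrite -(big_map (real_complex R) xpredT (fun x => 'X - x%:P)) => /prod_XsubC_eq.
move=> /(@tuple_permP _ _ _ D)[s lamE].
have lams i : real_complex R (tnth lam i) = d 0 (s i).
  have := congr1 (fun r => nth 0 r i) lamE.
  rewrite (nth_map 0) ?size_tuple // -tnth_nth => ->.
  by rewrite -tnth_nth !tnth_mktuple.
exists (row_perm s P); first exact: unitary_row_perm.
rewrite -/AC ACE invmx_unitary //; apply/matrixP => i j.
rewrite !mxE (reindex_inj (@perm_inj _ s)); apply: eq_bigr => k _ /=.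
rewrite !mxE; congr (_ * _).
rewrite (reindex_inj (@perm_inj _ s)); apply: eq_bigr => l _ /=.
by rewrite !mxE lams (inj_eq perm_inj).
Qed.

(** * Traces, quadratic forms and minors in terms of eigenvalues *)

Lemma sum_eigenvalues (R : rcfType) n (A : 'M[R]_n) (lam : n.-tuple R) :
  A^T = A -> char_poly A = \prod_(x <- lam) ('X - x%:P) ->
  \sum_k tnth lam k = \tr A.
Proof.
move=> Asym charA; have [U Uu AE] := symmetric_unitary_diag _ _ _ _ Asym charA.
apply: (@complexI R); rewrite -trace_map_mx AE -mulmxA mxtrace_mulC mulmxtVK //.
by rewrite mxtrace_diag raddf_sum; apply: eq_bigr => k _; rewrite mxE.
Qed.

Lemma sum_sqr_eigenvalues (R : rcfType) n (A : 'M[R]_n) (lam : n.-tuple R) :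
  A^T = A -> char_poly A = \prod_(x <- lam) ('X - x%:P) ->
  \sum_k tnth lam k ^+ 2 = \sum_i \sum_j A i j ^+ 2.
Proof.
move=> Asym charA; have [U Uu AE] := symmetric_unitary_diag _ _ _ _ Asym charA.
transitivity (\tr (A *m A)); last first.
  apply: eq_bigr => i _; rewrite mxE; apply: eq_bigr => j _.
  by rewrite -[in A j i]Asym mxE expr2.
apply: (@complexI R); rewrite -trace_map_mx map_mxM AE !mulmxA mulmxtVK //.
rewrite -mulmxA mxtrace_mulC !mulmxA mulmxtVK // mulmx_diag mxtrace_diag raddf_sum.
by apply: eq_bigr => k _; rewrite !mxE -rmorphM expr2.
Qed.

(** The weights are the squared moduli of the coordinates of [v] in an orthonormal eigenbasis. They
    depend only on [v] and [U], so the same weights serve the norm and the quadratic form, and both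
    Rayleigh bounds follow termwise. *)
Lemma quadratic_form_eigenvalues (R : rcfType) n (A : 'M[R]_n)
    (lam : n.-tuple R) (v : 'rV[R]_n) :
  A^T = A -> char_poly A = \prod_(x <- lam) ('X - x%:P) ->
  exists2 c : 'I_n -> R, forall k, 0 <= c k &
    \sum_k c k = (v *m v^T) 0 0 /\
    \sum_k c k * tnth lam k = (v *m A *m v^T) 0 0.
Proof.
move=> Asym charA; have [U Uu AE] := symmetric_unitary_diag _ _ _ _ Asym charA.
pose vC := map_mx (real_complex R) v; pose w := vC *m U^t*.
have wE : w^t* = U *m vC^T.
  rewrite /w trmx_mul map_mxM trmxCK; congr (_ *m _).
  by apply/matrixP => i j; rewrite !mxE; exact: conjc_real.
have normE k : w 0 k * (w 0 k)^* =
    real_complex R (complex.Re (w 0 k) ^+ 2 + complex.Im (w 0 k) ^+ 2).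
  case: (w 0 k) => a b; apply/eqP; rewrite eq_complex /=.
  by apply/andP; split; apply/eqP; ring.
exists (fun k => complex.Re (w 0 k) ^+ 2 + complex.Im (w 0 k) ^+ 2).
  by move=> k; rewrite addr_ge0 // sqr_ge0.
(* Stated for any [X] diagonalized by [U], since it is applied to both [A] and the identity. *)
have sumE (X : 'M[R]_n) (f : 'I_n -> R) :
    map_mx (real_complex R) X =
      U^t* *m diag_mx (\row_k real_complex R (f k)) *m U ->
  \sum_k (complex.Re (w 0 k) ^+ 2 + complex.Im (w 0 k) ^+ 2) * f k
    = (v *m X *m v^T) 0 0.
  move=> XE; apply: (@complexI R).
  have -> : real_complex R ((v *m X *m v^T) 0 0) =
    (map_mx (real_complex R) (v *m X *m v^T)) 0 0 by rewrite [RHS]mxE.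
  rewrite !map_mxM XE !mulmxA -/vC -/w -(mulmxA _ U) -map_trmx -/vC -wE mxE raddf_sum.
  apply: eq_bigr => k _ /=; rewrite mul_mx_diag; clearbody w.
  by rewrite !mxE [LHS]rmorphM /= mulrAC normE.
split; last exact: sumE.
have := sumE 1%:M (fun=> 1); rewrite mulmx1 => <-.
  by apply: eq_bigr => k _; rewrite mulr1.
rewrite map_mx1.
have -> : diag_mx (\row_(k < n) real_complex R 1) = 1%:M :> 'M[R[i]]_n.
  by apply/matrixP => i j; rewrite !mxE rmorph1.
by rewrite mulmx1; have := trmxC_unitary U; rewrite Uu => /unitarymxP; rewrite trmxCK.
Qed.

(* Here A - c is a rank one matrix, so that its 2 x 2 minors vanish. *)
Lemma minor_eigenvalues (R : rcfType) n (A : 'M[R]_n) (lam : n.-tuple R)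
    (k0 : 'I_n) (c : R) :
  A^T = A -> char_poly A = \prod_(x <- lam) ('X - x%:P) ->
  (forall k, k != k0 -> tnth lam k = c) ->
  let B := A - c%:M in forall i1 i2 j1 j2, B i1 j1 * B i2 j2 = B i1 j2 * B i2 j1.
Proof.
move=> Asym charA lamc B.
have [U Uu AE] := symmetric_unitary_diag _ _ _ _ Asym charA.
have BE i j : real_complex R (B i j) =
    (U k0 i)^* * (real_complex R (tnth lam k0 - c)) * U k0 j.
  have -> : real_complex R (B i j) = (map_mx (real_complex R) B) i j.
    by rewrite [RHS]mxE.
  rewrite map_mxB AE map_scalar_mx.
  have {1}-> : (real_complex R c)%:M = U^t* *m (real_complex R c)%:M *m U.
    rewrite scalar_mxC -mulmxA; have := trmxC_unitary U; rewrite Uu.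
    by move=> /unitarymxP; rewrite trmxCK => ->; rewrite mulmx1.
  rewrite -diag_const_mx -mulmxBl -mulmxBr -raddfB mul_mx_diag mxE (bigD1 k0) //= big1.
    by rewrite !mxE addr0 rmorphB.
  by move=> k k_neq; rewrite !mxE lamc // subrr mulr0 mul0r.
move=> i1 i2 j1 j2; apply: (@complexI R); rewrite !rmorphM /= !BE; ring.
Qed.

(** * Rayleigh bounds and two-term test vectors *)

Lemma rayleigh_ge (R : rcfType) n (A : 'M[R]_n) (lam : n.-tuple R)
    (v : 'rV[R]_n) (a : R) :
  A^T = A -> char_poly A = \prod_(x <- lam) ('X - x%:P) ->
  (forall k, a <= tnth lam k) ->
  a * (v *m v^T) 0 0 <= (v *m A *m v^T) 0 0.
Proof.
move=> Asym charA le_a.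
have [c c_ge0 [<- <-]] := quadratic_form_eigenvalues R n A lam v Asym charA.
rewrite mulr_sumr; apply: ler_sum => k _.
by rewrite mulrC ler_wpM2l.
Qed.

Lemma rayleigh_le (R : rcfType) n (A : 'M[R]_n) (lam : n.-tuple R)
    (v : 'rV[R]_n) (b : R) :
  A^T = A -> char_poly A = \prod_(x <- lam) ('X - x%:P) ->
  (forall k, tnth lam k <= b) ->
  (v *m A *m v^T) 0 0 <= b * (v *m v^T) 0 0.
Proof.
move=> Asym charA ge_b.
have [c c_ge0 [<- <-]] := quadratic_form_eigenvalues R n A lam v Asym charA.
rewrite mulr_sumr; apply: ler_sum => k _.
by rewrite [leRHS]mulrC ler_wpM2l.
Qed.

Lemma norm_delta2 (R : comNzRingType) n (i j : 'I_n) (e : R) : i != j ->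
  let v := delta_mx 0 i + e *: delta_mx 0 j : 'rV[R]_n in
  (v *m v^T) 0 0 = 1 + e ^+ 2.
Proof.
move=> neq_ij v; rewrite /v mulmxDl linearD linearZ /= !mulmxDr.
rewrite -!scalemxAl -!scalemxAr !trmx_delta !mul_delta_mx_cond !mxE.
by rewrite (negPf neq_ij) eq_sym (negPf neq_ij) !eqxx !mulr1n !mulr0n !mxE /=; ring.
Qed.

Lemma quadratic_delta2 (R : comNzRingType) n (A : 'M[R]_n) (i j : 'I_n)
    (e : R) :
  A^T = A ->
  let v := delta_mx 0 i + e *: delta_mx 0 j : 'rV[R]_n in
  (v *m A *m v^T) 0 0 = A i i + 2%:R * e * A i j + e ^+ 2 * A j j.
Proof.
move=> Asym v; have Aji : A j i = A i j by rewrite -[in LHS]Asym mxE.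
rewrite /v mulmxDl -scalemxAl -!rowE linearD linearZ /= !mulmxDr.
rewrite -!scalemxAr !trmx_delta -!colE !mxE Aji; ring.
Qed.

(** * Deviation of one value from the mean *)

Lemma sqr_dev_lt (R : realFieldType) n (f : 'I_n -> R) (k0 : 'I_n) (m s2 : R) :
  (1 < n)%N ->
  \sum_k f k = n%:R * m -> \sum_k f k ^+ 2 = n%:R * (m ^+ 2 + s2) ->
  (forall c, exists2 k, k != k0 & f k != c) ->
  (f k0 - m) ^+ 2 < s2 * (n%:R - 1).
Proof.
move=> n_gt1 sum1 sum2 nonconst.
have n1_gt0 : 0 < n%:R - 1 :> R by rewrite subr_gt0 ltr1n.
have n_gt0 : 0 < n%:R :> R by rewrite ltr0n ltnW.
(* [c] is the mean of the values other than [f k0]. Since these are not all equal to [c], their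
   squared deviations from it have a positive sum: this is the strict case of Cauchy-Schwarz. *)
set a := f k0; pose c := (n%:R * m - a) / (n%:R - 1).
have : 0 < \sum_(k | k != k0) (f k - c) ^+ 2.
  have [k k_neq fk] := nonconst c; rewrite (bigD1 k) //=.
  rewrite ltr_wpDr ?sumr_ge0 // => [l _|]; first exact: sqr_ge0.
  by rewrite exprn_even_gt0 //= subr_eq0.
have -> : \sum_(k | k != k0) (f k - c) ^+ 2 =
    n%:R * (m ^+ 2 + s2) - 2%:R * c * (n%:R * m) + n%:R * c ^+ 2 - (a - c) ^+ 2.
  apply: (addrI ((a - c) ^+ 2)); rewrite [RHS]addrC subrK -sum1 -sum2.
  transitivity (\sum_k (f k - c) ^+ 2); first by rewrite [RHS](bigD1 k0).
  under eq_bigr do rewrite sqrrB.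
  rewrite big_split sumrB /= sumr_const card_ord mulr_sumr.
  congr (_ - _ + _); last by rewrite mulr_natl.
  by apply: eq_bigr => k _; rewrite -mulr_natl; ring.
move=> var_gt0; rewrite -subr_gt0 -(pmulr_rgt0 _ n_gt0).
(* The gap in the claim, times n, is that positive sum times n - 1. *)
suff -> : n%:R * (s2 * (n%:R - 1) - (a - m) ^+ 2) = (n%:R - 1) *
    (n%:R * (m ^+ 2 + s2) - 2%:R * c * (n%:R * m) + n%:R * c ^+ 2 - (a - c) ^+ 2).
  exact: mulr_gt0.
by rewrite /c; field; rewrite gt_eqF.
Qed.

(** * Divisor sums and bounds on gcds *)

Lemma sum_sym (V : nmodType) n (F : nat -> nat -> V) :
  (forall i j, F i j = F j i) ->
  \sum_(i < n) \sum_(j < n) F i j =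
    \sum_(i < n) F i i + (\sum_(i < n) \sum_(j < i) F i j) *+ 2.
Proof.
move=> Fsym; elim: n => [|n IHn]; first by rewrite !big_ord0 mul0rn addr0.
rewrite !big_ord_recr /= mulrnDl addrACA -IHn.
under eq_bigr do rewrite big_ord_recr /=.
rewrite big_split /= -!addrA; congr (_ + _).
rewrite [F n n + _]addrC mulr2n -!addrA; congr (_ + _).
by apply: eq_bigr.
Qed.

(** Each block from [k * d] to [k.+1 * d], right end excluded, contains a single multiple of [d],
    its first element. *)
Lemma sum_dvdn_ord (V : nmodType) d m (g : nat -> V) : (0 < d)%N ->
  \sum_(0 <= j < m * d | (d %| j)%N) g (j %/ d)%N = \sum_(0 <= k < m) g k.
Proof.
move=> d_gt0; rewrite big_mkcond big_nat_mul; apply: eq_bigr => k _.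
rewrite big_ltn; last by rewrite mulSn; lia.
rewrite dvdn_mull // mulnK // big_nat_cond big1 /= ?addr0 // => j.
rewrite andbT => /andP[lt_kj lt_jk]; case: ifP => // /dvdnP[l jE].
by move: lt_kj lt_jk; rewrite jE !ltn_pmul2r // => ?; lia.
Qed.

(* Split the sum along the fibres of gcdn n, the fibre over d having
   totient (n %/ d) elements. *)
Lemma sum_gcdn_totient (R : nzSemiRingType) (f : nat -> R) n : (0 < n)%N ->
  \sum_(1 <= j < n.+1) f (gcdn n j) =
    \sum_(d <- divisors n) f d * (totient (n %/ d))%:R.
Proof.
move=> n_gt0.
(* The index n is traded for 0, as [gcdn n 0 = n], to match the range in [totient_count_coprime]. *)
have -> : \sum_(1 <= j < n.+1) f (gcdn n j) = \sum_(0 <= j < n) f (gcdn n j).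
  by rewrite big_nat_recr //= gcdnn [RHS]big_ltn // gcdn0 addrC big_add1.
transitivity (\sum_(0 <= j < n) \sum_(d <- divisors n | d == gcdn n j) f d).
  apply: eq_bigr => j _; rewrite -big_filter filter_pred1_uniq ?divisors_uniq //.
    by rewrite big_seq1.
  by rewrite -dvdn_divisors ?dvdn_gcdl.
rewrite (exchange_big_dep predT) //= big_seq [RHS]big_seq.
apply: eq_bigr => d; rewrite -dvdn_divisors // => /dvdnP[m nE].
have d_gt0 : (0 < d)%N by move: n_gt0; rewrite nE muln_gt0 => /andP[].
rewrite nE mulnK // totient_count_coprime natr_sum mulr_sumr.
rewrite -(sum_dvdn_ord _ d m (fun k => f d * (coprime m k)%:R)) //.
rewrite big_mkcond [RHS]big_mkcond; apply: eq_bigr => j _.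
case: (boolP (d %| j)%N) => [/dvdnP[k ->]|Ndj].
  rewrite mulnK // -muln_gcdl /coprime -[X in X == _]mul1n eqn_pmul2r //.
  by rewrite eq_sym; case: ifP; rewrite ?mulr1 ?mulr0.
by case: ifP => // /eqP dE; case/negP: Ndj; rewrite dE dvdn_gcdr.
Qed.

(** The gcd is at most [j.+1], hence a proper divisor of [i.+1], and its cofactor is at least 2. *)
Lemma gcdn_double_le i j : (j < i)%N -> (2 * gcdn i.+1 j.+1 <= i.+1)%N.
Proof.
move=> lt_ji; have /dvdnP[q iE] := dvdn_gcdl i.+1 j.+1.
have le_g : (gcdn i.+1 j.+1 <= j.+1)%N by rewrite dvdn_leq ?dvdn_gcdr.
by rewrite {2}iE leq_mul2r; apply/orP; right; case: q iE => [|[|q]] //; lia.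
Qed.

(* The bound j / 2 on the gcd of i < j is only used from the fourth row on: the
   first three contribute exactly 3, where it would give 11 / 2. *)
Lemma sum_gcdn_sqr_le n : (2 < n)%N ->
  (48 * \sum_(i < n) \sum_(j < i) gcdn i.+1 j.+1 ^ 2 + 3 * n ^ 2 + 2 * n + 120
    <= 3 * n ^ 4 + 2 * n ^ 3)%N.
Proof.
case: n => [|[|[|n]]] // _; elim: n => [|n IHn].
  (* For order 3 both sides equal 297; this equality fixes the constant 120. *)
  by rewrite !big_ord_recr !big_ord0.
rewrite big_ord_recr /=.
have : (4 * \sum_(j < n.+3) gcdn n.+4 j.+1 ^ 2 <= n.+3 * n.+4 ^ 2)%N.
  apply: (@leq_trans (\sum_(j < n.+3) n.+4 ^ 2)); last first.
    by rewrite sum_nat_const card_ord.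
  rewrite big_distrr /=; apply: leq_sum => j _.
  by rewrite -[4%N]/(2 ^ 2)%N -expnMn leq_sqr gcdn_double_le.
move: IHn; set S := (\sum_(i < _) _)%N; set T := (\sum_(i < _) _)%N.
by rewrite !expnS !expn0; nia.
Qed.

(** * Power sums and moments of the GCD matrix *)

Lemma sum_ordS (R : comNzRingType) n :
  2%:R * (\sum_(i < n) i.+1%:R) = n%:R * (n%:R + 1) :> R.
Proof.
elim: n => [|n IHn]; first by rewrite big_ord0 mulr0 mul0r.
by rewrite big_ord_recr /= mulrDr IHn -[n.+1%:R]natr1; ring.
Qed.

Lemma sum_ordS_sqr (R : comNzRingType) n :
  6%:R * (\sum_(i < n) i.+1%:R ^+ 2) = n%:R * (n%:R + 1) * (2%:R * n%:R + 1) :> R.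
Proof.
elim: n => [|n IHn]; first by rewrite big_ord0 mulr0 !mul0r.
by rewrite big_ord_recr /= mulrDr IHn -[n.+1%:R]natr1; ring.
Qed.

Lemma tr_gcd_matrix (R : nzSemiRingType) n : (gcd_matrix R n)^T = gcd_matrix R n.
Proof. by apply/matrixP => i j; rewrite !mxE gcdnC. Qed.

Lemma mxtrace_gcd_matrix (R : nzSemiRingType) n :
  \tr (gcd_matrix R n) = \sum_(i < n) i.+1%:R.
Proof. by apply: eq_bigr => i _; rewrite mxE gcdnn. Qed.

Lemma sum_sqr_gcd_matrix (R : nzSemiRingType) n :
  \sum_i \sum_j gcd_matrix R n i j ^+ 2 =
    \sum_(i < n) i.+1%:R ^+ 2 +
    (\sum_(i < n) \sum_(j < i) gcdn i.+1 j.+1 ^ 2)%N%:R *+ 2.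
Proof.
transitivity (\sum_(i < n) \sum_(j < n) (gcdn i.+1 j.+1)%:R ^+ 2 : R).
  by apply: eq_bigr => i _; apply: eq_bigr => j _; rewrite mxE.
rewrite (sum_sym R n (fun i j => (gcdn i.+1 j.+1)%:R ^+ 2)) => [|i j]; last first.
  by rewrite gcdnC.
rewrite natr_sum; congr (_ + _ *+ 2); apply: eq_bigr => i _; first by rewrite gcdnn.
by rewrite natr_sum; apply: eq_bigr => j _; rewrite natrX.
Qed.

(** By Cesaro's identity the Dirichlet product at i is the sum of gcd(i,j)^2 over j <= i, so the
    whole sum runs over the lower triangle of the matrix, diagonal included. *)
Lemma sum_dirichlet_gcd (R : nzSemiRingType) n :
  \sum_(1 <= i < n.+1)
      dirichlet (@arithN R \* @arithN R) (@arith_totient R) i =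
    \sum_(i < n) i.+1%:R ^+ 2 +
    (\sum_(i < n) \sum_(j < i) gcdn i.+1 j.+1 ^ 2)%N%:R.
Proof.
rewrite big_add1 /= big_mkord natr_sum -big_split; apply: eq_bigr => i _ /=.
rewrite /dirichlet -(sum_gcdn_totient _ (@arithN R \* @arithN R)) //.
rewrite big_nat_recr //= gcdnn addrC big_add1 /= big_mkord natr_sum -expr2.
by congr (_ + _); apply: eq_bigr => j _; rewrite natrX expr2.
Qed.

(** * Estimates behind the inner and outer bounds *)

(** This is q^2 < (n/2)^2, with [S] the sum of the squares up to n and [P] the sum of gcd(i,j)^2
    below the diagonal. *)
Lemma gcd_spread_sqr_lt (R : realFieldType) (N P S : R) :
  3%:R <= N -> 48%:R * P + 3%:R * N ^+ 2 + 2%:R * N + 120%:R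
    <= 3%:R * N ^+ 4 + 2%:R * N ^+ 3 ->
  6%:R * S = N * (N + 1) * (2%:R * N + 1) ->
  (N * (2%:R / N * (S + P) - (7%:R * N ^+ 2 + 12%:R * N + 5%:R) / 12%:R)
    + 2%:R * (N - 1)) / (N ^+ 2 - N) < (N / 2%:R) ^+ 2.
Proof.
move=> N3 leP SE.
have t_ge0 : 0 <= N - 3%:R by lra.
have den_gt0 : 0 < N ^+ 2 - N by nra.
rewrite ltr_pdivrMr //.
have -> : N * (2%:R / N * (S + P) - (7%:R * N ^+ 2 + 12%:R * N + 5%:R) / 12%:R)
   = 2%:R * (S + P) - N * (7%:R * N ^+ 2 + 12%:R * N + 5%:R) / 12%:R.
  by field; lra.
(* Inserting the bound on [P] and the value of [S] makes 24 times the gap at least this quartic. Its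
   expansion in powers of [N - 3] has only positive coefficients. *)
have : 0 < 3%:R * N ^+ 4 - 10%:R * N ^+ 3 + 3%:R * N ^+ 2 - 44%:R * N + 168%:R.
  have -> : 3%:R * N ^+ 4 - 10%:R * N ^+ 3 + 3%:R * N ^+ 2 - 44%:R * N + 168%:R =
    3%:R * (N - 3%:R) ^+ 4 + 26%:R * (N - 3%:R) ^+ 3 + 75%:R * (N - 3%:R) ^+ 2
      + 28%:R * (N - 3%:R) + 36%:R by ring.
  have := exprn_ge0 2 t_ge0; have := exprn_ge0 3 t_ge0; have := exprn_ge0 4 t_ge0.
  by lra.
move: leP SE; rewrite !exprS !expr0; lra.
Qed.

(* If the remaining eigenvalues all equal c, then gcd_matrix - c has rank one;
   its minors with rows 1, 2 and columns 1, 3, and with rows 1, 2 and columns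
   2, 3, then force c = 0 and c = 1. *)
Lemma gcd_eigenvalues_nonconst (R : rcfType) n (lam : n.-tuple R) (k0 : 'I_n)
    (c : R) :
  (2 < n)%N -> char_poly (gcd_matrix R n) = \prod_(x <- lam) ('X - x%:P) ->
  exists2 k, k != k0 & tnth lam k != c.
Proof.
move=> n_gt2 charA.
case: (boolP [exists k, (k != k0) && (tnth lam k != c)]) => [/existsP[k /andP[]]|].
  by exists k.
move=> /existsPn nonex.
have lamc k : k != k0 -> tnth lam k = c.
  by move=> k_neq; have := nonex k; rewrite k_neq /= negbK => /eqP.
have /= minorE := minor_eigenvalues R n _ lam k0 c (tr_gcd_matrix R n) charA lamc.
pose i0 := Ordinal (ltnW (ltnW n_gt2)); pose i1 := Ordinal (ltnW n_gt2).
pose i2 := Ordinal n_gt2.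
have := minorE i0 i1 i0 i2; have := minorE i0 i1 i1 i2; rewrite !mxE /=.
rewrite !gcd1n gcdn1 gcdnn (eqP (coprimenS 2)) mulr1n mulr0n => minor12 minor13.
by clear charA; exfalso; lra.
Qed.

Lemma gcd_lam_max_ge (R : rcfType) n (lam : n.-tuple R) (b : R) :
  (1 < n)%N -> char_poly (gcd_matrix R n) = \prod_(x <- lam) ('X - x%:P) ->
  (forall k, tnth lam k <= b) -> n%:R + 1 / 2%:R <= b.
Proof.
case: n lam => [|[|n]] // lam _ charA ge_b.
pose i : 'I_n.+2 := inord n; have neq_i : i != ord_max.
  by rewrite -val_eqE /= inordK // ltn_eqF.
(* For a matrix of order n the form takes the value (n - 1) + 2 + n = 2n + 1, consecutive integers
   being coprime, against a squared norm of 2. *)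
have := rayleigh_le R _ _ lam (delta_mx 0 i + 1 *: delta_mx 0 ord_max) b
  (tr_gcd_matrix R _) charA ge_b.
rewrite norm_delta2 // quadratic_delta2 ?tr_gcd_matrix // !mxE !gcdnn /= inordK //.
rewrite (eqP (coprimenS n.+1)) -![n.+2%:R]natr1 expr1n; lra.
Qed.

Lemma gcd_lam_min_le (R : rcfType) n (lam : n.-tuple R) (a : R) :
  (1 < n)%N -> char_poly (gcd_matrix R n) = \prod_(x <- lam) ('X - x%:P) ->
  (forall k, a <= tnth lam k) -> a <= 1 / 2%:R.
Proof.
case: n lam => [|[|n]] // lam _ charA le_a.
pose i : 'I_n.+2 := ord0; pose j : 'I_n.+2 := Ordinal (isT : (1 < n.+2)%N).
(* The form takes the value 1 - 2 + 2 = 1, against a squared norm of 2. *)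
have := rayleigh_ge R _ _ lam (delta_mx 0 i + (-1) *: delta_mx 0 j) a
  (tr_gcd_matrix R _) charA le_a.
rewrite norm_delta2 // quadratic_delta2 ?tr_gcd_matrix // !mxE !gcdnn /=.
by rewrite gcd1n sqrrN expr1n; lra.
Qed.

Theorem theorem2 (R : rcfType) (n : nat) (lam : n.-tuple R) :
  (2 < n)%N ->
  ordered_eigenvalues (gcd_matrix R n) lam ->
  let s := gcd_spread R n in
  let m : R := (n%:R + 1) / 2%:R in
  let q : R := Num.sqrt ((n%:R * s ^+ 2 + 2%:R * (n%:R - 1)) / (n%:R ^+ 2 - n%:R)) in
  let e : R := s * Num.sqrt (n%:R - 1) in
  (m - e < lam`_0 /\ lam`_0 < m - q) /\
  (m + q < lam`_(n.-1) /\ lam`_(n.-1) < m + e).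
Proof.
move=> n_gt2 [lam_sorted charA] s m q e.
have n_gt0 : (0 < n)%N by apply: ltnW (ltnW _).
have N_ge3 : 3%:R <= n%:R :> R by rewrite ler_nat.
have lam_le i j : (i <= j)%N -> (j < n)%N -> lam`_i <= lam`_j.
  move=> le_ij lt_jn; apply: (sorted_leq_nth le_trans lexx) => //;
    by rewrite inE size_tuple // (leq_ltn_trans le_ij).
have lam_min k : lam`_0 <= tnth lam k by rewrite (tnth_nth 0) lam_le.
have lam_max k : tnth lam k <= lam`_n.-1.
  by rewrite (tnth_nth 0) lam_le ?prednK // -ltnS prednK.
have Asym := tr_gcd_matrix R n.
have sum1 := sum_eigenvalues R n _ lam Asym charA.
have sum2 := sum_sqr_eigenvalues R n _ lam Asym charA.
have max_ge := gcd_lam_max_ge R n lam _ (ltnW n_gt2) charA lam_max.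
have min_le := gcd_lam_min_le R n lam _ (ltnW n_gt2) charA lam_min.
have nonconst k c := gcd_eigenvalues_nonconst R n lam k c n_gt2 charA.
clear charA.
rewrite mxtrace_gcd_matrix in sum1; rewrite sum_sqr_gcd_matrix in sum2.
have := sum_ordS R n; rewrite -sum1 => sum1E.
have := sum_gcdn_sqr_le n n_gt2; move: sum2 (sum_ordS_sqr R n).
set P := (\sum_(i < n) \sum_(j < i) _)%N; set S := \sum_(i < n) _ ^+ 2.
move=> sum2 SE leP.
have {}leP : 48%:R * P%:R + 3%:R * n%:R ^+ 2 + 2%:R * n%:R + 120%:R
    <= 3%:R * n%:R ^+ 4 + 2%:R * n%:R ^+ 3 :> R.
  by rewrite -!natrX -!natrM -!natrD ler_nat.
pose s2 := 2%:R / n%:R * (S + P%:R) - (7%:R * n%:R ^+ 2 + 12%:R * n%:R + 5%:R) / 12%:R.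
have sE : s = Num.sqrt s2 by rewrite /s /gcd_spread sum_dirichlet_gcd.
have {}sum1 : \sum_k tnth lam k = n%:R * m by rewrite /m; lra.
(* Here S/n + m^2 = (7n^2 + 12n + 5)/12, so [s2] equals (S + 2P)/n - m^2, the variance. *)
have {}sum2 : \sum_k tnth lam k ^+ 2 = n%:R * (m ^+ 2 + s2).
  have SE' : S = n%:R * (n%:R + 1) * (2%:R * n%:R + 1) / 6%:R by lra.
  rewrite sum2 /m /s2 SE'.
  by field; lra.
have dev_lt k : (tnth lam k - m) ^+ 2 < s2 * (n%:R - 1).
  by apply: sqr_dev_lt sum1 sum2 (nonconst k); exact: ltnW.
(* [Num.sqrt] is 0 on negative arguments, so [s ^+ 2 = s2] needs this sign; the deviation bound at
   any index provides it. *)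
have s2_ge0 : 0 <= s2.
  have := le_lt_trans (sqr_ge0 _) (dev_lt (Ordinal n_gt0)).
  by rewrite pmulr_lgt0; [exact: ltW | lra].
have dev_lt_e k : `|tnth lam k - m| < e.
  rewrite -sqrtr_sqr /e sE -sqrtrM // ltr_sqrt //.
  exact: le_lt_trans (sqr_ge0 _) (dev_lt k).
have q_lt : q < n%:R / 2%:R.
  have n2_ge0 : 0 <= n%:R / 2%:R :> R by lra.
  rewrite -[ltRHS](ger0_norm n2_ge0) -sqrtr_sqr /q ltr_sqrt; last first.
    by rewrite exprn_gt0 //; lra.
  by rewrite sE sqr_sqrtr // gcd_spread_sqr_lt.
have := dev_lt_e (Ordinal n_gt0).
have lt_pred : (n.-1 < n)%N by rewrite prednK.
have := dev_lt_e (Ordinal lt_pred).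
rewrite !(tnth_nth 0) !ltr_norml /= /m => /andP[_ lt_max] /andP[lt_min _].
(* The inner bounds use (n + 1/2) - m = m - 1/2 = n/2 > q. *)
by split; split; lra.
Qed.
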